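(* There exist absolute constants $c>0$ and $\epsilon_0>0$ such that, for any $\epsilon\in(0,\epsilon_0)$, given samples from an unknown $c$-balanced Bayes net $P$ over $\{0,1\}^n$ with unknown tree structure, distinguishing between the cases $P=U$ and $\|P-U\|_1>\epsilon$ with probability $2/3$ requires $\Omega(n/\epsilon^2)$ samples, where $U$ is the uniform distribution over $\{0,1\}^n$. Moreover, one can take $c=1/3$.
   Context: A Bayes net over $\{0,1\}^n$ with structure a DAG $\mathcal{S}$ on $[n]$ (topologically sorted) is a distribution where $\Pr[X_i=1\mid X_1,\dots,X_{i-1}]$ depends only on the coordinates at the parents of $i$. It has tree structure if each node has at most one parent. Its conditional probability table consists of $p_{i,a}=\Pr[X_i=1\mid X_{\Pi(i)}=a]$ over nodes $i$ and parent assignments $a$. A tree-structured Bayes net is $c$-balanced if all these $p_{i,a}$ lie in $[c,1-c]$. $\|P-Q\|_1=\sum_x|P(x)-Q(x)|$. *)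

(* Defs.v *)
From HB Require Import structures.
From mathcomp Require Import all_boot all_order all_algebra.
From mathcomp Require Import reals.

Set Implicit Arguments.
Unset Strict Implicit.
Unset Printing Implicit Defensive.

Import Order.TTheory GRing.Theory Num.Theory.
Local Open Scope ring_scope.

Notation cube n := {ffun 'I_n -> bool}.

Section Distributions.
Variables (R : realType) (n : nat).
Implicit Types P Q : {ffun cube n -> R}.

Definition is_distribution P := (forall x, 0 <= P x) /\ \sum_x P x = 1.

Definition uniform : {ffun cube n -> R} := [ffun => #|{: cube n}|%:R^-1].

Definition l1_dist P Q : R := \sum_x `|P x - Q x|.

Definition Pr P (A : {set cube n}) : R := \sum_(x in A) P x.

(* Meaningful only when 0 < Pr P B. *)
Definition condPr P (A B : {set cube n}) : R := Pr P (A :&: B) / Pr P B.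

End Distributions.

Section BayesNets.
Variables (R : realType) (n : nat).
Implicit Types (P : {ffun cube n -> R}) (S : rel 'I_n) (i j : 'I_n).

(* [S j i] is an edge from [j] to [i].  A relation that only goes from smaller
   to larger indices is exactly a DAG for which 0, ..., n-1 is a topological
   order. *)
Definition topologically_sorted S := forall j i, S j i -> (j < i)%N.

Definition parents S i : {set 'I_n} := [set j | S j i].

Definition predecessors i : {set 'I_n} := [set j : 'I_n | (j < i)%N].

(* The event X_D = a_D.  An assignment to the coordinates in [D] is represented
   by any point of the cube extending it. *)
Definition agree_on (D : {set 'I_n}) (a : cube n) : {set cube n} :=
  [set x : cube n | [forall j in D, x j == a j]].

Definition is_one i : {set cube n} := [set x : cube n | x i].

(* Pr[X_i = 1 | X_1, ..., X_{i-1}] is a function of the coordinates at the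
   parents of i; the conditional probability is only considered where it is
   defined, i.e. at prefixes of positive probability. *)
Definition bayes_net S P :=
  is_distribution P /\
  forall i (x y : cube n),
    0 < Pr P (agree_on (predecessors i) x) ->
    0 < Pr P (agree_on (predecessors i) y) ->
    (forall j, j \in parents S i -> x j = y j) ->
    condPr P (is_one i) (agree_on (predecessors i) x) =
    condPr P (is_one i) (agree_on (predecessors i) y).

Definition tree_structure S := forall i, (#|parents S i| <= 1)%N.

(* The entry p_{i,a} of the conditional probability table. *)
Definition cpt S P i (a : cube n) : R :=
  condPr P (is_one i) (agree_on (parents S i) a).

(* When 0 < c and [P] is a Bayes net on a sorted [S], this forces every parent
   assignment to have positive probability, by induction along the topological
   order, so the guard discards nothing. *)
Definition balanced (c : R) S P :=
  forall i (a : cube n), 0 < Pr P (agree_on (parents S i) a) ->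
    c <= cpt S P i a <= 1 - c.

Definition balanced_tree_bayes_net (c : R) P :=
  exists S : rel 'I_n,
    [/\ topologically_sorted S, tree_structure S, bayes_net S P
      & balanced c S P].

End BayesNets.

Section Testing.
Variables (R : realType) (n m : nat).
Implicit Types (P : {ffun cube n -> R}) (T : {ffun 'I_m -> cube n} -> R).

(* A possibly randomized algorithm reading m samples: [T s] is the probability,
   over its internal coins, that it answers "P = U" on the sample [s]. *)
Definition randomized_test T := forall s, 0 <= T s <= 1.

Definition accept_prob P T : R :=
  \sum_(s : {ffun 'I_m -> cube n}) (\prod_(k < m) P (s k)) * T s.

Definition reject_prob P T : R :=
  \sum_(s : {ffun 'I_m -> cube n}) (\prod_(k < m) P (s k)) * (1 - T s).

Definition distinguishes_uniform (c eps : R) T :=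
  forall P, balanced_tree_bayes_net c P ->
    (P = uniform R n -> 2 / 3 <= accept_prob P T) /\
    (eps < l1_dist P (uniform R n) -> 2 / 3 <= reject_prob P T).

End Testing.

(* [K] is the constant hidden in Omega(n / eps^2): it depends neither on n nor
   on eps. *)
Definition requires_n_over_eps2_samples (R : realType) (c eps0 : R) :=
  exists2 K : R, 0 < K &
    forall eps : R, 0 < eps < eps0 ->
    forall (n m : nat) (T : {ffun 'I_m -> cube n} -> R),
      randomized_test T -> distinguishes_uniform c eps T ->
      K * (n%:R / eps ^+ 2) <= m%:R.

(* Main.v *)
Require Import Defs.
From HB Require Import structures.
From mathcomp Require Import all_boot all_order all_algebra all_fingroup.
From mathcomp Require Import reals ring lra.

Set Implicit Arguments.
Unset Strict Implicit.
Unset Printing Implicit Defensive.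

Import Order.TTheory GRing.Theory Num.Theory.
Local Open Scope ring_scope.

(** Le Cam's method with a random matching.  Split the nodes into a left and a
    right half of size about [k = n / 2] and let a uniform permutation [pi] of
    [k] points pair them up; [P_pi] has density [prod_a (1 + delta y_a)] with
    respect to the uniform distribution, where [y_a] is the product of the two
    signs of the [a]-th pair and [delta] is of order [eps / sqrt k].

    Expanding in characters, [<P_pi, P_pi'>] is the sum of [delta ^ (2 #|F|)] over
    the sets [F] invariant under [pi pi'^-1], hence at most
    [(1 + delta^2) ^ fix * (1 + delta^4) ^ k], with [fix] the number of fixed
    points of [pi pi'^-1].  A random permutation has about one fixed point, so
    the [m]-th power of this quantity averages to nearly 1 as long as
    [m * delta^2] is small, that is, [m << n / eps^2]: then [m] samples from a
    random [P_pi] look uniform. *)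

(** * Characters of the cube and their orthogonality *)

Section Fourier.
Variables (R : realType) (n : nat).
Implicit Types (x : cube n) (i j : 'I_n) (A B : {set 'I_n}).

Let N : R := #|{: cube n}|%:R.

Lemma card_cube_gt0 : 0 < N.
Proof. by rewrite ltr0n card_ffun card_bool expn_gt0. Qed.

Lemma sum_cube1 : \sum_(x : cube n) (1 : R) = N.
Proof. by rewrite sumr_const. Qed.

Definition spin i x : R := if x i then 1 else -1.

Definition flip i x : cube n := [ffun j => (j == i) (+) x j].

Lemma flipK i : involutive (flip i).
Proof. by move=> x; apply/ffunP=> j; rewrite !ffunE addbA addbb. Qed.

Lemma spin_flip i j x :
  spin i (flip j x) = if i == j then - spin i x else spin i x.
Proof. by rewrite /spin ffunE; case: eqP => _; case: (x i); rewrite ?opprK. Qed.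

Lemma spin2 i x : spin i x * spin i x = 1.
Proof. by rewrite /spin; case: (x i); rewrite ?mulr1 // mulrNN mulr1. Qed.

(** The involution [flip i] reindexes the sum into its own opposite. Every cancellation over the
    cube below rests on this. *)
Lemma sum_odd i (g : cube n -> R) :
  (forall x, g (flip i x) = - g x) -> \sum_x g x = 0.
Proof.
move=> odd_g; have: \sum_x g x = - \sum_x g x.
  rewrite -sumrN (reindex_inj (inv_inj (flipK i))) /=.
  by apply: eq_bigr => x _; rewrite odd_g.
lra.
Qed.

Definition char A x : R := \prod_(i in A) spin i x.

Lemma char_flip A i x :
  char A (flip i x) = if i \in A then - char A x else char A x.
Proof.
rewrite /char; case: ifP => iA; last first.
  by apply: eq_bigr => j jA; rewrite spin_flip; case: eqP => // ji; rewrite -ji jA in iA.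
rewrite (bigD1 i) //= [in RHS](bigD1 i) //= spin_flip eqxx mulNr.
by congr (- (_ * _)); apply: eq_bigr => j /andP[_ /negPf ji]; rewrite spin_flip ji.
Qed.

Lemma char2 A x : char A x * char A x = 1.
Proof. by rewrite /char -big_split big1 //= => i _; rewrite spin2. Qed.

(** For distinct sets, flipping a coordinate of the symmetric difference changes the sign of the
    summand. *)
Lemma sum_charM A B : \sum_x char A x * char B x = (A == B)%:R * N.
Proof.
have [->|neqAB] := eqVneq A B.
  by rewrite mul1r -sum_cube1; apply: eq_bigr => x _; rewrite char2.
rewrite mul0r.
have [i Di] : exists i, (i \in A) != (i \in B).
  apply/existsP; rewrite -negb_forall; apply: contraNN neqAB => /forallP eqAB.
  by apply/eqP/setP=> i; apply/eqP.
apply: (@sum_odd i) => x; rewrite !char_flip.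
by case: (i \in A) (i \in B) Di => [] [] //= _; rewrite ?mulNr ?mulrN.
Qed.

Lemma sum_char A : \sum_x char A x = (A == set0)%:R * N.
Proof.
rewrite -sum_charM; apply: eq_bigr => x _.
by rewrite [char set0 x]big_set0 mulr1.
Qed.

Lemma prod_char (I : finType) (E : I -> {set 'I_n}) (F : {set I}) x :
  (forall a b, a != b -> [disjoint E a & E b]) ->
  \prod_(a in F) char (E a) x = char (\bigcup_(a in F) E a) x.
Proof.
move=> dE; rewrite /char [RHS]big_mkcond.
under [LHS]eq_bigr do rewrite big_mkcond.
rewrite exchange_big /=; apply: eq_bigr => i _.
case: bigcupP => [[a aF iEa]|nF].
  rewrite (bigD1 a) //= iEa big1 ?mulr1 // => b /andP[_ ba].
  by rewrite (disjointFl (dE _ _ ba)).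
by rewrite big1 // => a aF; case: ifP => // iEa; case: nF; exists a.
Qed.

(** Characters of disjoint sets multiply to the character of the union, so expanding the product
    yields one character per set of factors. *)
Lemma prod_affine_char k (E : 'I_k -> {set 'I_n}) (u v : R) x :
  (forall a b, a != b -> [disjoint E a & E b]) ->
  \prod_a (u + v * char (E a) x) =
  \sum_(F : {set 'I_k})
     u ^+ #|~: F| * v ^+ #|F| * char (\bigcup_(a in F) E a) x.
Proof.
move=> dE; under eq_bigr do rewrite addrC.
rewrite bigA_distr; apply: eq_bigr => F _.
rewrite -(prod_char _ _ dE) -mulrA.
rewrite (bigID (mem F)) /= mulrC; congr (_ * _).
  rewrite (eq_bigr (fun=> u)) => [|a /negPf-> //].
  by rewrite prodr_const; congr (_ ^+ _); apply: eq_card => a; rewrite !inE.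
rewrite (eq_bigr (fun a => v * char (E a) x)) => [|a -> //].
by rewrite big_split prodr_const.
Qed.

(** Only [F = set0] survives, all other unions being nonempty: the signs [char (E a)] behave as
    independent fair coins. *)
Lemma sum_prod_affine_char k (E : 'I_k -> {set 'I_n}) (u v : R) :
  (forall a b, a != b -> [disjoint E a & E b]) -> (forall a, E a != set0) ->
  \sum_x \prod_a (u + v * char (E a) x) = u ^+ k * N.
Proof.
move=> dE E0; under eq_bigr do rewrite prod_affine_char //.
rewrite exchange_big /= (bigD1 set0) //= [X in _ + X]big1 => [|F F0].
  rewrite addr0 -big_distrr /= sum_char setC0 cardsT card_ord cards0 big_set0.
  by rewrite eqxx expr0 mulr1 mul1r.
rewrite -big_distrr /= sum_char.
have [/eqP/bigcup0P E'0|_] := eqVneq; last by rewrite mul0r mulr0.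
by case/set0Pn: F0 => a /E'0/eqP; rewrite (negPf (E0 a)).
Qed.

End Fourier.

(** * Bayes nets given by sequential biases *)

Section Density.
Variables (R : realType) (n : nat) (S : rel 'I_n).
Variable q : 'I_n -> cube n -> R.
Hypothesis sortedS : topologically_sorted S.
Hypothesis q_parents : forall i (x y : cube n),
  (forall j, j \in parents S i -> x j = y j) -> q i x = q i y.
Hypothesis q_small : forall i x, `|q i x| <= 1 / 3.

Let N : R := #|{: cube n}|%:R.

(* Given the smaller coordinates, X_i has mean [q i] as a +1/-1 variable. *)
Definition bias_density : {ffun cube n -> R} :=
  [ffun x => N^-1 * \prod_i (1 + spin R i x * q i x)].

Lemma q_flip (i j : 'I_n) x : (i <= j)%N -> q i (flip j x) = q i x.
Proof.
move=> le_ij; apply: q_parents => l; rewrite inE => /sortedS lt_li.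
rewrite ffunE; case: eqP => // lj; rewrite lj in lt_li.
by move: lt_li; rewrite ltnNge le_ij.
Qed.

(** Factors are summed out from the largest index down: flipping the top coordinate negates its spin
    and leaves [psi], its own bias and all smaller factors unchanged. *)
Lemma sum_prefix l (psi : cube n -> R) : (l <= n)%N ->
  (forall (j : 'I_n) x, (l <= j)%N -> psi (flip j x) = psi x) ->
  \sum_x psi x * \prod_i (1 + spin R i x * q i x) =
  \sum_x psi x * \prod_(i < n | (i < l)%N) (1 + spin R i x * q i x).
Proof.
have [d] := ubnP (n - l); elim: d l => // d IHd l.
move=> lt_d; rewrite leq_eqVlt => /predU1P[->|lt_ln] inv_psi.
  by apply: eq_bigr => x _; congr (_ * _); apply: eq_bigl => i; rewrite ltn_ord.
rewrite (IHd l.+1) //; first last.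
- by move=> j x lt_lj; apply: inv_psi; apply: ltnW.
- by move: lt_d; rewrite ltnS; apply: leq_trans; rewrite ltn_sub2l.
pose i0 := Ordinal lt_ln.
pose w x := \prod_(i < n | (i < l)%N) (1 + spin R i x * q i x).
have split_w x : \prod_(i < n | (i < l.+1)%N) (1 + spin R i x * q i x)
    = w x + spin R i0 x * q i0 x * w x.
  rewrite (bigD1 i0) //= mulrDl mul1r; congr (_ + _ * _); apply: eq_bigl => i;
  by rewrite -val_eqE /= ltnS [RHS]ltn_neqAle andbC.
under eq_bigr do rewrite split_w mulrDr.
rewrite big_split /= [X in _ + X](@sum_odd _ _ i0) ?addr0 // => x.
have w_flip : w (flip i0 x) = w x.
  apply: eq_bigr => i lt_il; rewrite q_flip ?(ltnW lt_il) // spin_flip.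
  by rewrite -val_eqE /= (ltn_eqF lt_il).
by rewrite inv_psi // w_flip q_flip // spin_flip eqxx; ring.
Qed.

Lemma sum_bias_density (psi : cube n -> R) :
  \sum_x bias_density x * psi x =
  N^-1 * \sum_x psi x * \prod_i (1 + spin R i x * q i x).
Proof. by rewrite big_distrr /=; apply: eq_bigr => x _; rewrite ffunE; ring. Qed.

(** This is the conditional expectation property of [q i], with [phi] a function of the earlier
    coordinates. *)
Lemma sum_bias_density_spin (i : 'I_n) (phi : cube n -> R) :
  (forall (j : 'I_n) x, (i <= j)%N -> phi (flip j x) = phi x) ->
  \sum_x bias_density x * (phi x * spin R i x) =
  \sum_x bias_density x * (phi x * q i x).
Proof.
move=> inv_phi; rewrite !sum_bias_density; congr (_ * _).
(* The left side keeps factor [i], since [spin i] depends on coordinate [i]; the right side drops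
   it. Squaring the spin to 1 isolates the [q i] term, and what remains is odd. *)
rewrite (@sum_prefix i.+1) //; last first.
  move=> j x lt_ij; rewrite inv_phi ?(ltnW lt_ij) // spin_flip.
  by rewrite -val_eqE /= (ltn_eqF lt_ij).
rewrite (@sum_prefix i) ?(ltnW (ltn_ord i)) //; last first.
  by move=> j x le_ij; rewrite inv_phi // q_flip.
pose w x := \prod_(j < n | (j < i)%N) (1 + spin R j x * q j x).
have split_w x : \prod_(j < n | (j < i.+1)%N) (1 + spin R j x * q j x)
    = (1 + spin R i x * q i x) * w x.
  rewrite (bigD1 i) //=; congr (_ * _); apply: eq_bigl => j.
  by rewrite -val_eqE /= ltnS [RHS]ltn_neqAle andbC.
have split_t x : phi x * spin R i x *
    \prod_(j < n | (j < i.+1)%N) (1 + spin R j x * q j x)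
  = phi x * q i x * w x + phi x * w x * spin R i x.
  by rewrite split_w -[phi x * q i x]mul1r -[in RHS](spin2 R i x); ring.
under eq_bigr do rewrite split_t.
rewrite big_split /= [X in _ + X](@sum_odd _ _ i) ?addr0 // => x.
have w_flip : w (flip i x) = w x.
  apply: eq_bigr => j lt_ji; rewrite q_flip ?(ltnW lt_ji) // spin_flip.
  by rewrite -val_eqE /= (ltn_eqF lt_ji).
by rewrite inv_phi // w_flip spin_flip eqxx; ring.
Qed.

Lemma bias_density_is_distribution : is_distribution bias_density.
Proof.
split=> [x|].
  rewrite ffunE mulr_ge0 ?invr_ge0 ?ler0n ?prodr_ge0 // => i _.
  have := q_small i x; rewrite ler_norml => /andP[]; rewrite /spin.
  by case: (x i); lra.
have := sum_bias_density (fun=> 1).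
under eq_bigr do rewrite mulr1.
move=> ->; rewrite (@sum_prefix 0) // (eq_bigr (fun=> 1)) => [|x _].
  by rewrite sum_cube1 mulVf // gt_eqF // card_cube_gt0.
by rewrite mul1r big_pred0.
Qed.

(** The range allowed for [D] serves twice: the predecessors give the Bayes net condition, the
    parents give the conditional probability table. *)
Lemma condPr_bias_density i (D : {set 'I_n}) a :
  parents S i \subset D -> D \subset predecessors i ->
  0 < Pr bias_density (agree_on D a) ->
  condPr bias_density (is_one i) (agree_on D a) = (1 + q i a) / 2.
Proof.
move=> /subsetP parD /subsetP Dpred PrD.
pose phi x : R := (x \in agree_on D a)%:R.
have PrE : Pr bias_density (agree_on D a) = \sum_x bias_density x * phi x.
  rewrite /Pr big_mkcond; apply: eq_bigr => x _.
  by rewrite /phi; case: ifP; rewrite ?mulr1 ?mulr0.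
have inv_phi (j : 'I_n) x : (i <= j)%N -> phi (flip j x) = phi x.
  move=> le_ij; congr (nat_of_bool _)%:R; rewrite !inE.
  apply: eq_forallb_in => l /Dpred; rewrite inE => lt_li.
  by rewrite ffunE -val_eqE /= (ltn_eqF (leq_trans lt_li le_ij)).
have PrI : Pr bias_density (is_one i :&: agree_on D a)
    = (\sum_x bias_density x * phi x
       + \sum_x bias_density x * (phi x * spin R i x)) / 2.
  rewrite /Pr big_mkcond -big_split big_distrl /=; apply: eq_bigr => x _.
  rewrite /phi in_setI [x \in is_one i]inE /spin.
  by case: (x \in agree_on D a); case: (x i) => /=; field.
rewrite /condPr PrI sum_bias_density_spin //.
have -> : \sum_x bias_density x * (phi x * q i x)
    = Pr bias_density (agree_on D a) * q i a.
  rewrite PrE big_distrl /=; apply: eq_bigr => x _; rewrite -mulrA; congr (_ * _).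
  rewrite /phi; case: (boolP (x \in _)) => [|_]; last by rewrite !mul0r.
  rewrite inE => /'forall_in_eqP xa; congr (_ * _).
  by apply: q_parents => j /parD /xa.
by rewrite -PrE; field; rewrite gt_eqF.
Qed.

(** A bias of absolute value at most 1/3 puts the table entry [(1 + q) / 2] in [[1/3, 2/3]]. *)
Lemma bias_density_balanced_tree : tree_structure S ->
  balanced_tree_bayes_net (1 / 3) bias_density.
Proof.
move=> treeS.
have par_pred i : parents S i \subset predecessors i.
  by apply/subsetP=> j; rewrite !inE => /sortedS.
exists S; split => //.
  split=> [|i x y Px Py xy]; first exact: bias_density_is_distribution.
  by rewrite !condPr_bias_density // (q_parents xy).
move=> i a Pa; rewrite /cpt condPr_bias_density //.
by have := q_small i a; rewrite ler_norml => /andP[]; lra.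
Qed.

End Density.

(** * Elementary bounds on powers *)

Section RealPowers.
Variable R : realType.
Implicit Type x : R.

Lemma bernoulli x k : 0 <= x -> 1 + k%:R * x <= (1 + x) ^+ k.
Proof.
move=> x0; elim: k => [|k IHk]; first by rewrite mul0r addr0.
rewrite exprS; apply: (@le_trans _ _ ((1 + x) * (1 + k%:R * x))).
  by rewrite -natr1; have : 0 <= k%:R :> R := ler0n _ _; nra.
by rewrite ler_wpM2l // addr_ge0.
Qed.

(** The product [(1 + x) ^ k * (1 - k x)] equals 1 at [k = 0] and does not increase with [k]. *)
Lemma expr1D_le_inv x k : 0 <= x -> k%:R * x < 1 ->
  (1 + x) ^+ k <= (1 - k%:R * x)^-1.
Proof.
move=> x0 kx1; rewrite -[leRHS]mul1r ler_pdivlMr ?subr_gt0 // {kx1}.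
elim: k => [|k IHk]; first by rewrite mul0r subr0 mulr1.
apply: le_trans IHk; rewrite exprS mulrAC [leLHS]mulrC ler_wpM2l //.
  by rewrite exprn_ge0 // addr_ge0.
by rewrite -natr1; have : 0 <= k%:R :> R := ler0n _ _; nra.
Qed.

Lemma sum_geometric_le (w : R) k : 0 <= w < 1 ->
  \sum_(i < k) w ^+ i <= (1 - w)^-1.
Proof.
move=> /andP[w0 w1]; rewrite -[leRHS]mul1r ler_pdivlMr ?subr_gt0 //.
have := subrX1 w k; have := exprn_ge0 k w0; nra.
Qed.

End RealPowers.

(** * Le Cam's second moment bound *)

Section LeCam.
Variables (R : realType) (n m : nat).
Implicit Type P : {ffun cube n -> R}.

Let N : R := #|{: cube n}|%:R.

Lemma accept_add_reject P T : is_distribution P ->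
  @accept_prob R n m P T + reject_prob P T = 1.
Proof.
case=> _ P1; rewrite -big_split /=.
transitivity (\sum_(s : {ffun 'I_m -> cube n}) \prod_(k < m) P (s k)).
  by apply: eq_bigr => s _; ring.
by rewrite -(bigA_distr_bigA (fun=> P)) /= P1 big1.
Qed.

(** Acceptance under the uniform mixture of the [P i] is at least 1/3 less likely than under uniform
    samples, which forces a chi-square distance of at least 1/9. The double sum is the second moment
    of the mixture, expanded over pairs. *)
Lemma le_cam_second_moment (I : finType) (P : I -> {ffun cube n -> R})
    (T : {ffun 'I_m -> cube n} -> R) :
  (0 < #|I|)%N -> randomized_test T -> (forall i, is_distribution (P i)) ->
  2 / 3 <= accept_prob (uniform R n) T ->
  (forall i, 2 / 3 <= reject_prob (P i) T) ->
  10 / 9 * #|I|%:R ^+ 2 <=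
  \sum_i \sum_j (N * \sum_x P i x * P j x) ^+ m.
Proof.
move=> I0 T01 distP accU rejP.
have N0 : 0 < N := card_cube_gt0 R n.
(* [M^-1] is the density of [m] uniform samples, and [Q] that of [m] samples from one random
   [P i]. *)
pose M := N ^+ m; have M0 : 0 < M by rewrite exprn_gt0.
pose K : R := #|I|%:R; have K0 : 0 < K by rewrite ltr0n.
pose Q (s : {ffun 'I_m -> cube n}) : R := K^-1 * \sum_i \prod_(k < m) P i (s k).
have sum1 : \sum_(s : {ffun 'I_m -> cube n}) M^-1 = 1.
  by rewrite sumr_const card_ffun card_ord -mulr_natl natrX divff // gt_eqF.
have sumQ : \sum_s Q s = 1.
  rewrite -big_distrr exchange_big /= (eq_bigr (fun=> 1)) => [|i _].
    by rewrite sumr_const mulVf // gt_eqF.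
  by rewrite -(bigA_distr_bigA (fun=> P i)) /= (distP i).2 big1.
have sumQ2 : K ^+ 2 * (M * \sum_s Q s * Q s) =
    \sum_i \sum_j (N * \sum_x P i x * P j x) ^+ m.
  have -> : \sum_s Q s * Q s = K ^- 2 * \sum_i \sum_j
      \sum_(s : {ffun 'I_m -> cube n}) \prod_(k < m) (P i (s k) * P j (s k)).
    under [in RHS]eq_bigr do rewrite exchange_big /=.
    rewrite [in RHS]exchange_big big_distrr /=; apply: eq_bigr => s _.
    rewrite /Q mulrACA -invfM -expr2 big_distrlr /=; congr (_ * _).
    by apply: eq_bigr => i _; apply: eq_bigr => j _; rewrite big_split.
  rewrite [M * _]mulrCA mulVKf ?expf_neq0 ?gt_eqF // big_distrr /=.
  apply: eq_bigr => i _; rewrite big_distrr /=; apply: eq_bigr => j _.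
  rewrite -(bigA_distr_bigA (fun=> fun x => P i x * P j x)) /= exprMn.
  by rewrite prodr_const card_ord.
rewrite -sumQ2 mulrC ler_wpM2l ?exprn_ge0 ?(ltW K0) //.
have accQ : \sum_s Q s * T s <= 1 / 3.
  have -> : \sum_s Q s * T s = K^-1 * \sum_i accept_prob (P i) T.
    rewrite /accept_prob exchange_big big_distrr /=; apply: eq_bigr => s _.
    by rewrite /Q -mulrA big_distrl.
  rewrite ler_pdivrMl // mulr_natl -sumr_const.
  apply: ler_sum => i _.
  by have := accept_add_reject T (distP i); have := rejP i; lra.
have accUE : accept_prob (uniform R n) T = \sum_s M^-1 * T s.
  apply: eq_bigr => s _; congr (_ * _).
  rewrite (eq_bigr (fun=> N^-1)) => [|k _]; last by rewrite ffunE.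
  by rewrite prodr_const card_ord exprVn.
have gap : 1 / 3 <= \sum_s (M^-1 * T s - Q s * T s).
  by rewrite sumrB -accUE; lra.
(* The bracket is the chi-square distance of [Q] from uniform. The [t ^ 2] part costs at most 1/6,
   which leaves chi-square at least 1/9. *)
have : 1 / 3 <= 3 / 2 * (M * (\sum_s Q s * Q s) - 2 * (\sum_s Q s)
                         + \sum_(s : {ffun 'I_m -> cube n}) M^-1)
        + 1 / 6 * \sum_(s : {ffun 'I_m -> cube n}) M^-1.
  apply: le_trans gap _.
  rewrite 3!big_distrr -sumrB -big_split !big_distrr -big_split /=.
  apply: ler_sum => s _; have /andP[Ts0 Ts1] := T01 s.
  set g := Q s; set t := T s.
  have W0 : 0 < M^-1 by rewrite invr_gt0.
  (* Complete the square: [a t <= (3 M a^2 + t^2 / (3 M)) / 2]. *)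
  have sq : 0 <= M^-1 * (3 * (1 - M * g) - t) ^+ 2.
    by rewrite mulr_ge0 ?sqr_ge0 // ltW.
  have sqt : 0 <= M^-1 * (1 - t ^+ 2).
    by rewrite mulr_ge0 ?(ltW W0) // subr_ge0 expr_le1.
  rewrite -subr_ge0; set lhs := (X in 0 <= X).
  have -> : lhs = 1 / 6 * (M^-1 * (3 * (1 - M * g) - t) ^+ 2)
                  + 1 / 6 * (M^-1 * (1 - t ^+ 2)).
    by rewrite /lhs; field; rewrite gt_eqF.
  by rewrite addr_ge0 // mulr_ge0 ?divr_ge0.
rewrite sumQ sum1; lra.
Qed.

End LeCam.

(** * Cycles and fixed points of permutations *)

Section Permutations.
Variable R : realType.

Definition fixed_points (T : finType) (s : {perm T}) : {set T} :=
  [set a | s a == a].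

Lemma mem_invariant_porbit (T : finType) (s : {perm T}) (F : {set T}) a b :
  s @: F = F -> b \in porbit s a -> (b \in F) = (a \in F).
Proof.
move=> sF /porbitP[i ->]; elim: i => [|i IHi]; first by rewrite perm1.
by rewrite expgSr permM -IHi -{1}sF mem_imset //; apply: perm_inj.
Qed.

Lemma trivIset_porbits (T : finType) (s : {perm T}) : trivIset (porbits s).
Proof.
apply/trivIsetP=> _ _ /imsetP[a _ ->] /imsetP[b _ ->]; apply: contraR.
case/pred0Pn=> c /= /andP[ca cb]; apply/eqP.
by move: ca cb; rewrite -!eq_porbit_mem => /eqP <- /eqP <-.
Qed.

(* Invariant sets are unions of cycles. *)
Lemma sum_invariant_sets (T : finType) (s : {perm T}) (x : R) : 0 <= x ->
  \sum_(F : {set T} | s @: F == F) x ^+ #|F|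
    <= \prod_(C in porbits s) (1 + x ^+ #|C|).
Proof.
move=> x0.
pose orbs (F : {set T}) := [set C in porbits s | C \subset F].
have cover_orbs (F : {set T}) : s @: F == F -> cover (orbs F) = F.
  move=> /eqP sF; apply/setP=> a; apply/bigcupP/idP => [[C]|aF].
    by rewrite inE => /andP[_ /subsetP]; apply.
  exists (porbit s a); last exact: porbit_id.
  rewrite inE imset_f //=; apply/subsetP=> b ba.
  by rewrite (mem_invariant_porbit sF ba).
have orbs_inj : {in [pred F : {set T} | s @: F == F] &, injective orbs}.
  by move=> F G /cover_orbs FE /cover_orbs GE FG; rewrite -FE -GE FG.
have -> : \prod_(C in porbits s) (1 + x ^+ #|C|) =
    \sum_(Q : {set {set T}} | Q \subset porbits s) \prod_(C in Q) x ^+ #|C|.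
  rewrite big_mkcond /=.
  (* The value 0 outside [porbits s] lets [bigA_distr] range over all families: those containing a
     non-cycle get product 0. *)
  rewrite (eq_bigr (fun C => (if C \in porbits s then x ^+ #|C| else 0) + 1));
    last by move=> C _; case: ifP; rewrite ?add0r // addrC.
  rewrite bigA_distr [RHS]big_mkcond /=; apply: eq_bigr => Q _.
  case: ifP => [/subsetP subQ|/negbT/subsetPn[C CQ /negPf nC]].
    by rewrite [RHS]big_mkcond; apply: eq_bigr => C _; case: ifP => // /subQ ->.
  by rewrite (bigD1 C) //= CQ nC mul0r.
have -> : \sum_(F : {set T} | s @: F == F) x ^+ #|F| =
    \sum_(Q in [set orbs F | F in [pred F : {set T} | s @: F == F]])
      \prod_(C in Q) x ^+ #|C|.
  rewrite big_imset //=; apply: eq_big => [F|F sF]; first by rewrite inE.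
  rewrite -{1}(cover_orbs F sF) -prodr_const big_trivIset /=.
    by apply: eq_bigr => C _; rewrite prodr_const.
  by apply: trivIsetS (trivIset_porbits s); apply/subsetP=> C; rewrite inE => /andP[].
(* Each [orbs F] is a subfamily of [porbits s], and the terms are nonnegative. *)
rewrite [leLHS]big_mkcond [leRHS]big_mkcond; apply: ler_sum => Q _.
have Q0 : 0 <= \prod_(C in Q) x ^+ #|C|.
  by apply: prodr_ge0 => C _; rewrite exprn_ge0.
case: ifP => [/imsetP[F _ ->]|_]; last by case: ifP.
by rewrite ifT //; apply/subsetP=> C; rewrite inE => /andP[].
Qed.

(** Cycles of length 1 are the fixed points. Each longer cycle contributes at most [1 + x ^ 2]
    because [x <= 1], and there are at most [#|T|] cycles. *)
Lemma prod_porbits_le (T : finType) (s : {perm T}) (x : R) : 0 <= x <= 1 ->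
  \prod_(C in porbits s) (1 + x ^+ #|C|)
    <= (1 + x) ^+ #|fixed_points s| * (1 + x ^+ 2) ^+ #|T|.
Proof.
move=> /andP[x0 x1]; rewrite (bigID (fun C : {set T} => #|C| == 1%N)) /=.
apply: ler_pM; try by apply: prodr_ge0 => C _; rewrite addr_ge0 ?exprn_ge0.
  rewrite (eq_bigr (fun=> 1 + x)) => [|C /andP[_ /eqP-> //]].
  rewrite prodr_const ler_weXn2l ?lerDl //.
  rewrite -(card_imset (fixed_points s) set1_inj); apply/subset_leq_card/subsetP.
  move=> C /andP[/imsetP[a _ ->] /cards1P[b Cb]]; apply/imsetP; exists b => //.
  have ab : a = b by apply/set1P; rewrite -Cb porbit_id.
  by have := mem_porbit s 1 a; rewrite expg1 Cb in_set1 inE ab.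
apply: (@le_trans _ _ (\prod_(C in porbits s | #|C| != 1%N) (1 + x ^+ 2))).
  apply: ler_prod => C /andP[/imsetP[a _ ->] C1].
  rewrite addr_ge0 ?exprn_ge0 //= lerD2l ler_wiXn2l //.
  have := card_porbit_neq0 s a.
  by case: #|_| C1 => [|[|]].
rewrite prodr_const ler_weXn2l ?lerDl ?exprn_ge0 //.
apply: (@leq_trans #|porbits s|).
  by apply/subset_leq_card/subsetP=> C /andP[].
exact: leq_imset_card.
Qed.

(* The [j]-th factorial moment of the number of fixed points is at most 1. *)
Lemma sum_expr_fixed_points k (w : R) : 0 <= w < 1 ->
  \sum_(s : 'S_k) (1 + w) ^+ #|fixed_points s| <= k`!%:R / (1 - w).
Proof.
move=> w01; have /andP[w0 _] := w01.
have expand (s : 'S_k) : (1 + w) ^+ #|fixed_points s| =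
    \sum_(A : {set 'I_k} | A \subset fixed_points s) w ^+ #|A|.
  rewrite -prodr_const big_mkcond /=.
  rewrite (eq_bigr (fun a => (if a \in fixed_points s then w else 0) + 1));
    last by move=> a _; case: ifP; rewrite ?add0r // addrC.
  rewrite bigA_distr [RHS]big_mkcond /=; apply: eq_bigr => A _.
  case: ifP => [/subsetP subA|/negbT/subsetPn[a aA /negPf na]].
    rewrite -prodr_const [RHS]big_mkcond.
    by apply: eq_bigr => a _; case: ifP => // /subA ->.
  by rewrite (bigD1 a) //= aA na mul0r.
under eq_bigr do rewrite expand.
rewrite (exchange_big_dep predT) //=.
(* Fixing [A] pointwise amounts to permuting the complement of [A]. *)
have count (A : {set 'I_k}) :
    \sum_(s : 'S_k | A \subset fixed_points s) w ^+ #|A|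
    = w ^+ #|A| * (k - #|A|)`!%:R.
  have cA : #|~: A| = (k - #|A|)%N by rewrite cardsCs setCK card_ord.
  rewrite sumr_const mulr_natr -cA -card_perm; congr (_ *+ _).
  apply: eq_card => s; apply/subsetP/subsetP => sub a.
    by rewrite !inE; apply: contra => /sub; rewrite inE.
  by move=> aA; rewrite inE; apply: contraLR aA => /sub; rewrite inE.
under eq_bigr do rewrite count.
(* Grouped by size [j], the coefficient of [w ^ j] is ['C(k, j) (k - j)! = k! / j!], at most
   [k!]. *)
rewrite (partition_big (fun A : {set 'I_k} => inord #|A| : 'I_k.+1) predT) //=.
apply: (@le_trans _ _ (k`!%:R * \sum_(j < k.+1) w ^+ j)); last first.
  by rewrite ler_wpM2l // sum_geometric_le.
rewrite big_distrr /=; apply: ler_sum => j _.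
have cardA (A : {set 'I_k}) : (inord #|A| == j) = (#|A| == j).
  by rewrite -val_eqE /= inordK // ltnS -[leqRHS]card_ord max_card.
under eq_bigl do rewrite cardA.
rewrite (eq_bigr (fun=> w ^+ j * (k - j)`!%:R)) => [|A /eqP-> //].
rewrite sumr_const -[leLHS]mulr_natr -mulrA mulrC ler_wpM2r ?exprn_ge0 // -natrM.
rewrite (_ : #|_| = 'C(k, j)); last first.
  by have := card_draws 'I_k j; rewrite card_ord cardsE.
have le_jk : (j <= k)%N by rewrite -ltnS.
rewrite ler_nat -(bin_fact le_jk) [leqLHS]mulnC mulnA leq_mul2r.
by rewrite leq_pmulr ?fact_gt0 ?orbT.
Qed.

End Permutations.

(** * Products of independent edge signs and their distance to uniform *)

Section EdgeProducts.
Variables (R : realType) (n k : nat) (E : 'I_k -> {set 'I_n}).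
Hypothesis disjE : forall a b, a != b -> [disjoint E a & E b].
Hypothesis neE : forall a, E a != set0.

Let N : R := #|{: cube n}|%:R.

Definition edge_density (delta : R) : {ffun cube n -> R} :=
  [ffun x => N^-1 * \prod_a (1 + delta * char R (E a) x)].

(** On signs [f] is affine, so by independence only its mean [u] enters. *)
Lemma sum_prod_edges (f : R -> R) (u v : R) :
  (forall y, y * y = 1 -> f y = u + v * y) ->
  \sum_x \prod_a f (char R (E a) x) = u ^+ k * N.
Proof.
move=> fE; rewrite -(sum_prod_affine_char u v disjE neE).
by apply: eq_bigr => x _; apply: eq_bigr => a _; rewrite fE ?char2.
Qed.

(* With [Z = P / U - 1] and [V = prod (1 + t y_a)], integrate the pointwise bound
   [|Z| >= Z V / 4 - (Z^2 / eta + eta V^4) / 128]: every moment is then a product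
   over the independent signs [y_a]. *)
Lemma l1_dist_edge_density (eta : R) : (0 < k)%N -> 0 < eta <= 1 / 2 ->
  eta / 32 <= l1_dist (edge_density (eta / Num.sqrt k%:R)) (uniform R n).
Proof.
move=> k0 /andP[eta0 eta1].
have N0 : 0 < N := card_cube_gt0 R n.
have kR1 : 1 <= k%:R :> R by rewrite ler1n.
set r := Num.sqrt _; have r0 : 0 < r by rewrite sqrtr_gt0 ltr0n.
have rr : r * r = k%:R by rewrite -expr2 sqr_sqrtr.
(* The scale of [t] balances two needs: [k t^2 = 1/16] keeps the fourth moment of [V] at most 2,
   while the correlation [k delta t = eta / 4] stays of order [eta]. *)
set delta := eta / r; pose t := (4 * r)^-1.
have t0 : 0 < t by rewrite invr_gt0 mulr_gt0.
have delta0 : 0 < delta by rewrite divr_gt0.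
have kdt : k%:R * (delta * t) = eta / 4.
  by rewrite -rr /delta /t; field; rewrite gt_eqF.
have kdd : k%:R * (delta * delta) = eta * eta.
  by rewrite -rr /delta; field; rewrite gt_eqF.
have ktt : k%:R * (t * t) = 1 / 16.
  by rewrite -rr /t; field; rewrite gt_eqF.
have tt0 : 0 <= t * t <= 1 / 16.
  by rewrite mulr_ge0 ?(ltW t0) //= -ktt ler_peMl // mulr_ge0 ?(ltW t0).
pose Z x := \prod_a (1 + delta * char R (E a) x) - 1.
pose V x := \prod_a (1 + t * char R (E a) x).
have l1E : l1_dist (edge_density delta) (uniform R n) = N^-1 * \sum_x `|Z x|.
  rewrite big_distrr; apply: eq_bigr => x _; rewrite !ffunE /= -/N.
  rewrite -[X in _ - X]mulr1 -mulrBr normrM ger0_norm // invr_ge0 ltW //.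
have sumL : \sum_x \prod_a (1 + delta * char R (E a) x) = N.
  by rewrite sum_prod_affine_char // expr1n mul1r.
have sumV : \sum_x V x = N.
  by rewrite sum_prod_affine_char // expr1n mul1r.
have sumZV : \sum_x Z x * V x = ((1 + delta * t) ^+ k - 1) * N.
  rewrite mulrBl mul1r -{2}sumV.
  rewrite -(@sum_prod_edges (fun y => (1 + delta * y) * (1 + t * y)) _ (delta + t)).
    by rewrite -sumrB; apply: eq_bigr => x _; rewrite big_split /Z /V /= mulrBl mul1r.
  move=> y yy; transitivity (1 + delta * t * (y * y) + (delta + t) * y); first ring.
  by rewrite yy mulr1.
have sumZ2 : \sum_x Z x ^+ 2 = ((1 + delta * delta) ^+ k - 1) * N.
  transitivity (\sum_x (\prod_a (1 + delta * char R (E a) x) ^+ 2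
     - 2 * \prod_a (1 + delta * char R (E a) x) + 1)).
    by apply: eq_bigr => x _; rewrite prodrXl /Z; ring.
  rewrite big_split sumrB -big_distrr /= sumL sum_cube1 -/N.
  rewrite (@sum_prod_edges (fun y => (1 + delta * y) ^+ 2)
             (1 + delta * delta) (2 * delta)); first by ring.
  move=> y yy; transitivity (1 + delta * delta * (y * y) + 2 * delta * y); first ring.
  by rewrite yy mulr1.
have sumV4 : \sum_x V x ^+ 4 = (1 + (6 * (t * t) + (t * t) ^+ 2)) ^+ k * N.
  rewrite -(@sum_prod_edges (fun y => (1 + t * y) ^+ 4) _ (4 * t + 4 * (t * t * t))).
    by apply: eq_bigr => x _; rewrite prodrXl.
  move=> y yy; transitivity (1 + 4 * t * y + 6 * (t * t) * (y * y)
    + 4 * (t * t * t) * y * (y * y) + (t * t) ^+ 2 * (y * y) * (y * y)); first ring.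
  by rewrite yy; ring.
have V0 x : 0 <= V x.
  apply: prodr_ge0 => a _.
  have : char R (E a) x * char R (E a) x = 1 := char2 R (E a) x.
  have [_] := andP tt0.
  set y := char _ _ _ => tt16 yy; have : (t * y) * (t * y) <= 1 / 16.
    by rewrite mulrACA yy mulr1.
  nra.
have pointwise x :
    Z x * V x / 4 - (Z x ^+ 2 / eta + eta * V x ^+ 4) / 128 <= `|Z x|.
  rewrite -(real_normK (num_real (Z x))).
  set z := `|Z x|; have z0 : 0 <= z by rewrite normr_ge0.
  have ZV : Z x * V x <= z * V x by rewrite ler_wpM2r ?ler_norm.
  (* [sq1] gives [z V / 4 <= z + z V^2 / 64], and [sq2] bounds [z V^2] by
     [(z^2 / eta + eta V^4) / 2]. *)
  have sq1 : 0 <= z * (V x / 8 - 1) ^+ 2 by rewrite mulr_ge0 ?sqr_ge0.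
  have sq2 : 0 <= (z - eta * V x ^+ 2) ^+ 2 / eta.
    by rewrite divr_ge0 ?sqr_ge0 // ltW.
  have sq2E : (z - eta * V x ^+ 2) ^+ 2 / eta
      = z ^+ 2 / eta - 2 * (z * V x ^+ 2) + eta * V x ^+ 4.
    by field; rewrite gt_eqF.
  rewrite sq2E in sq2; move: sq1 sq2 ZV; rewrite -/z; nra.
have ZVge : eta / 4 <= (1 + delta * t) ^+ k - 1.
  have := @bernoulli _ (delta * t) k; rewrite kdt => /(_ (mulr_ge0 _ _)).
  by rewrite !(ltW delta0) !(ltW t0) => /(_ isT isT); lra.
have Z2le : (1 + delta * delta) ^+ k - 1 <= 2 * eta ^+ 2.
  rewrite lerBlDr; apply: le_trans (expr1D_le_inv _ _) _.
  - by rewrite mulr_ge0 ?(ltW delta0).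
  - by rewrite kdd; nra.
  have ee : 0 <= eta * eta <= 1 / 4 by apply/andP; split; nra.
  by rewrite kdd expr2 -[leLHS]mul1r ler_pdivrMr; move: (eta * eta) ee => e /andP[]; nra.
have V4le : (1 + (6 * (t * t) + (t * t) ^+ 2)) ^+ k <= 2.
  have /andP[tt_ge0 tt16] := tt0.
  have kw : k%:R * (6 * (t * t) + (t * t) ^+ 2) <= 1 / 2.
    have -> : k%:R * (6 * (t * t) + (t * t) ^+ 2) =
      6 * (k%:R * (t * t)) + (k%:R * (t * t)) * (t * t) by ring.
    by rewrite ktt; lra.
  apply: le_trans (expr1D_le_inv _ _) _; first by nra.
    by lra.
  by rewrite -[leLHS]mul1r ler_pdivrMr; lra.
(* After summation the moment bounds give [(eta / 4) / 4 - (2 eta + 2 eta) / 128 = eta / 32]. *)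
have := @ler_sum _ _ (index_enum _) xpredT _ _ (fun x _ => pointwise x).
rewrite sumrB -!big_distrl big_split -big_distrl -big_distrr /=.
rewrite sumZV sumZ2 sumV4 l1E ler_pdivlMl // => bound.
apply: le_trans bound.
set p := (_ ^+ k - 1) in ZVge *; set p2 := (_ ^+ k - 1) in Z2le *.
set p4 := (_ ^+ k) in V4le *.
have p2eta : p2 / eta <= 2 * eta.
  by rewrite ler_pdivrMr // -mulrA -expr2.
have -> : p * N / 4 - (p2 * N / eta + eta * (p4 * N)) / 128 =
    N * (p / 4 - (p2 / eta + eta * p4) / 128) by field; rewrite gt_eqF.
rewrite ler_wpM2l ?(ltW N0) //.
have : eta * p4 <= eta * 2 by rewrite ler_wpM2l // ltW.
by move: p2eta ZVge; lra.
Qed.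

End EdgeProducts.

(** * Random matchings as Bayes nets *)

(* Every edge joins a right node [k' + a] to the left node of index [pi a - 1].
   When [pi a = 0] there is no left node and the edge degenerates to a bias on
   the right node, which covers odd [n], and [n = 1] in particular. *)
Section MatchedNets.
Variables (R : realType) (n k' : nat).
Hypothesis lt_kn : (k' + k' < n)%N.
Notation k := k'.+1.
Implicit Types (pi : 'S_k) (a b : 'I_k) (i j : 'I_n) (F G : {set 'I_k}).

Let N : R := #|{: cube n}|%:R.

(** The [k'] left nodes and [k' + 1] right nodes occupy the first [2 k' + 1] indices, which [lt_kn]
    makes available. *)
Lemma right_subproof a : (k' + a < n)%N.
Proof. by apply: leq_ltn_trans lt_kn; rewrite leq_add2l -ltnS. Qed.

Definition right_node a : 'I_n := Ordinal (right_subproof a).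

(** A set with at most one element: since the character of the empty set is 1, the degenerate edge
    obeys the same formulas as the others. *)
Definition left_nodes b : {set 'I_n} :=
  [set i : 'I_n | (i < k')%N && (i.+1 == b :> nat)].

Definition edge pi a : {set 'I_n} := right_node a |: left_nodes (pi a).

Lemma right_node_inj : injective right_node.
Proof. by move=> a b /(congr1 val)/= /addnI/val_inj. Qed.

Lemma right_notin_left a b : right_node a \notin left_nodes b.
Proof. by rewrite inE /= ltnNge leq_addr. Qed.

Lemma left_nodes_inj i b b' :
  i \in left_nodes b -> i \in left_nodes b' -> b = b'.
Proof.
by rewrite !inE => /andP[_ /eqP ib] /andP[_ /eqP ib']; apply: ord_inj; rewrite -ib.
Qed.

Lemma right_in_edge pi a b : (right_node b \in edge pi a) = (b == a).
Proof.
by rewrite in_setU1 (negPf (right_notin_left _ _)) orbF (inj_eq right_node_inj).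
Qed.

Lemma edge_neq0 pi a : edge pi a != set0.
Proof. by apply/set0Pn; exists (right_node a); rewrite right_in_edge. Qed.

Lemma edge_disjoint pi a b : a != b -> [disjoint edge pi a & edge pi b].
Proof.
move=> ab; rewrite -setI_eq0; apply/eqP/setP=> i; rewrite in_setI in_set0.
apply/negP=> /andP[]; rewrite {1}/edge in_setU1 => /predU1P[->|ia].
  by rewrite right_in_edge (negPf ab).
rewrite in_setU1 => /predU1P[ib|ib].
  by move: ia; rewrite ib (negPf (right_notin_left _ _)).
by move/eqP: ab; apply; apply: (@perm_inj _ pi); apply: left_nodes_inj ia ib.
Qed.

Definition matching_rel pi : rel 'I_n :=
  fun j i => [exists a, (i == right_node a) && (j \in left_nodes (pi a))].

Definition matching_bias (delta : R) pi i (x : cube n) : R :=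
  if [pick a | i == right_node a] is Some a
  then delta * char R (left_nodes (pi a)) x else 0.

Lemma matching_bias_right (delta : R) pi a x :
  matching_bias delta pi (right_node a) x
    = delta * char R (left_nodes (pi a)) x.
Proof.
rewrite /matching_bias; case: pickP => [b /eqP/right_node_inj<- //|].
by move=> /(_ a); rewrite eqxx.
Qed.

(** The sign of an edge is the spin of its right node times the character of its left part, so each
    factor is a bias at a right node; all other nodes are unbiased. *)
Lemma edge_densityE (delta : R) pi :
  edge_density (edge pi) delta = bias_density (matching_bias delta pi).
Proof.
apply/ffunP=> x; rewrite !ffunE; congr (_ * _).
rewrite [RHS](bigID (mem [set right_node a | a in 'I_k])) /=.
rewrite [X in _ * X]big1 => [|i ni]; last first.
  rewrite /matching_bias; case: pickP => [a /eqP ia|_]; last by rewrite mulr0 addr0.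
  by case/imsetP: ni; exists a.
rewrite mulr1 big_imset /=; last by move=> a b _ _; apply: right_node_inj.
apply: eq_bigr => a _; rewrite matching_bias_right /edge.
by rewrite [char R (_ |: _) x]big_setU1 ?right_notin_left //= mulrCA.
Qed.

(** Edges go from an index below [k'] to one at least [k'], and a right node has at most one left
    partner. *)
Lemma edge_density_balanced_tree (delta : R) pi : 0 <= delta <= 1 / 3 ->
  balanced_tree_bayes_net (1 / 3) (edge_density (edge pi) delta).
Proof.
move=> /andP[d0 d3]; rewrite edge_densityE.
apply: (@bias_density_balanced_tree _ _ (matching_rel pi)).
- move=> j i /existsP[a /andP[/eqP-> ]]; rewrite inE => /andP[lt_jk _].
  by rewrite /= (leq_trans lt_jk) // leq_addr.
- move=> i x y xy; rewrite /matching_bias; case: pickP => // a ia.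
  congr (_ * _); apply: eq_bigr => j ja; rewrite /spin xy // inE.
  by apply/existsP; exists a; rewrite ia.
- move=> i x; rewrite /matching_bias; case: pickP => [a _|_].
    rewrite normrM (ger0_norm d0).
    have /eqP := char2 R (left_nodes (pi a)) x.
    by rewrite -expr2 sqrf_eq1 => /pred2P[]->; rewrite ?normrN normr1 mulr1.
  by rewrite normr0; lra.
- move=> i; apply/card_le1_eqP => j j'; rewrite !inE.
  move=> /existsP[a /andP[/eqP-> ja]] /existsP[b /andP[/eqP/right_node_inj<- jb]].
  move: ja jb; rewrite !inE => /andP[_ /eqP ja] /andP[_ /eqP jb].
  by apply: ord_inj; apply: succn_inj; rewrite ja jb.
Qed.

(** The right nodes of the union recover [F], and its left nodes recover the image of [F] away from
    index 0. *)
Lemma cover_edges_inj pi pi' F G :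
  \bigcup_(a in F) edge pi a = \bigcup_(a in G) edge pi' a ->
  F = G /\ pi @: F = pi' @: F.
Proof.
move=> eqFG.
have right_cover pi1 F1 a :
    (right_node a \in \bigcup_(b in F1) edge pi1 b) = (a \in F1).
  apply/bigcupP/idP => [[b bF]|aF]; first by rewrite right_in_edge => /eqP->.
  by exists a; rewrite ?right_in_edge.
have eqF : F = G.
  by apply/setP=> a; rewrite -(right_cover pi) eqFG right_cover.
split=> //; move: eqFG; rewrite -eqF => {G eqF} eqFF.
have left_cover pi1 i b : i \in left_nodes b ->
    (i \in \bigcup_(a in F) edge pi1 a) = (b \in pi1 @: F).
  move=> ib; apply/bigcupP/imsetP => [[a aF]|[a aF bE]]; last first.
    by exists a; rewrite // in_setU1 -bE ib orbT.
  rewrite in_setU1 => /predU1P[ia|ia]; last by exists a => //; apply: left_nodes_inj ia.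
  by move: ib; rewrite ia (negPf (right_notin_left _ _)).
have eqD : pi @: F :\ ord0 = pi' @: F :\ ord0.
  apply/setP=> b; rewrite !in_setD1; have [//|b0] := eqVneq b ord0; rewrite !andTb.
  have b_gt0 : (0 < b)%N by rewrite lt0n.
  have lt_bk : (b.-1 < k')%N by rewrite -ltnS prednK.
  have lt_bn : (b.-1 < n)%N.
    by apply: leq_trans lt_bk _; apply: leq_trans (ltnW lt_kn); rewrite leq_addr.
  have bl : Ordinal lt_bn \in left_nodes b by rewrite inE /= lt_bk prednK /=.
  by rewrite -!(left_cover _ _ _ bl) eqFF.
(* Both images have [#|F|] elements, so they agree at the missing index 0 too. *)
have eq0 : (ord0 \in pi @: F) = (ord0 \in pi' @: F).
  have : #|pi @: F| = #|pi' @: F| by rewrite !card_imset //; apply: perm_inj.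
  rewrite (cardsD1 ord0) [in RHS](cardsD1 ord0) eqD => /addIn.
  by do 2!case: (_ \in _).
apply/setP=> b; have [->//|b0] := eqVneq b ord0.
by have /setP/(_ b) := eqD; rewrite !in_setD1 b0.
Qed.

(** Orthogonality keeps only the pairs [F], [G] with equal unions; [cover_edges_inj] then forces
    [F = G] and equal images. *)
Lemma edge_density_inner (delta : R) pi pi' : 0 <= delta ->
  N * (\sum_x edge_density (edge pi) delta x * edge_density (edge pi') delta x)
  <= \sum_(F : {set 'I_k} | pi @: F == pi' @: F) (delta * delta) ^+ #|F|.
Proof.
move=> d0; have N0 : 0 < N := card_cube_gt0 R n.
pose cov pi1 F := \bigcup_(a in F) edge pi1 a.
have densE pi1 x : edge_density (edge pi1) delta x =
    N^-1 * \sum_(F : {set 'I_k}) delta ^+ #|F| * char R (cov pi1 F) x.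
  rewrite ffunE prod_affine_char; last exact: edge_disjoint.
  by congr (_ * _); apply: eq_bigr => F _; rewrite expr1n mul1r.
have -> : N * (\sum_x edge_density (edge pi) delta x
                      * edge_density (edge pi') delta x)
    = \sum_(F : {set 'I_k}) \sum_(G : {set 'I_k}) delta ^+ #|F| * delta ^+ #|G| * (cov pi F == cov pi' G)%:R.
  transitivity (N^-1 * \sum_(F : {set 'I_k}) \sum_(G : {set 'I_k}) delta ^+ #|F| * delta ^+ #|G|
       * \sum_x char R (cov pi F) x * char R (cov pi' G) x); last first.
    rewrite big_distrr; apply: eq_bigr => F _; rewrite big_distrr.
    apply: eq_bigr => G _; rewrite sum_charM -/N /=.
    by field; rewrite gt_eqF.
  have -> : N^-1 = N * (N^-1 * N^-1) by field; rewrite gt_eqF.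
  rewrite -mulrA; congr (_ * _).
  under [in RHS]eq_bigr => F _ do (under eq_bigr do rewrite big_distrr /=;
    rewrite exchange_big /=).
  rewrite exchange_big big_distrr /=; apply: eq_bigr => x _.
  rewrite !densE mulrACA big_distrlr /=; congr (_ * _).
  by apply: eq_bigr => F _; apply: eq_bigr => G _; rewrite mulrACA.
rewrite [leRHS]big_mkcond; apply: ler_sum => F _.
rewrite (bigD1 F) //= [X in _ + X]big1 => [|G GF]; last first.
  case: eqP => [/cover_edges_inj[FG _]|_]; last by rewrite mulr0.
  by rewrite FG eqxx in GF.
rewrite addr0 -exprMn; case: (eqVneq (cov pi F)) => [/cover_edges_inj[_ ->]|_].
  by rewrite eqxx mulr1.
by rewrite mulr0; case: ifP => // _; rewrite exprn_ge0 // mulr_ge0.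
Qed.

Lemma second_moment_lt (m : nat) (delta : R) : 0 <= delta ->
  k%:R * (delta * delta) <= 1 / 9 -> m%:R * (delta * delta) < 1 / 32 ->
  \sum_(pi : 'S_k) \sum_(pi' : 'S_k)
     (N * \sum_x edge_density (edge pi) delta x
                 * edge_density (edge pi') delta x) ^+ m
  < 10 / 9 * #|'S_k|%:R ^+ 2.
Proof.
move=> d0; set x := delta * delta => kx mx.
have x0 : 0 <= x by rewrite mulr_ge0.
have x1 : x <= 1.
  have : x <= k%:R * x by rewrite ler_peMl // ler1n.
  by move: kx; lra.
(* The [m]-th power is absorbed into [w] and [c]. The bounds [w <= 1/31] and [c <= 288/287] give
   [c / (1 - w) < 10/9]. *)
pose w := (1 + x) ^+ m - 1; pose c := (1 + x ^+ 2) ^+ (k * m).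
have w0 : 0 <= w by rewrite subr_ge0 exprn_ege1 // lerDl.
have w31 : w <= 1 / 31.
  rewrite lerBlDr; apply: le_trans (expr1D_le_inv x0 _) _; first by lra.
  by rewrite -[leLHS]mul1r ler_pdivrMr; lra.
have c0 : 0 <= c by rewrite exprn_ge0 // addr_ge0 // exprn_ge0.
have c_le : c <= 288 / 287.
  have km : (k * m)%:R * x ^+ 2 <= 1 / 288.
    have -> : (k * m)%:R * x ^+ 2 = (k%:R * x) * (m%:R * x) by rewrite natrM; ring.
    have -> : 1 / 288 = (1 / 9) * (1 / 32) :> R by field.
    by rewrite ler_pM ?mulr_ge0 // ltW.
  apply: le_trans (expr1D_le_inv (exprn_ge0 _ x0) _) _; first by lra.
  by rewrite -[leLHS]mul1r ler_pdivrMr; lra.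
have pair_le pi pi' : (N * \sum_y edge_density (edge pi) delta y
      * edge_density (edge pi') delta y) ^+ m
    <= (1 + w) ^+ #|fixed_points (pi * pi'^-1)%g| * c.
  have -> : (1 + w) ^+ #|fixed_points (pi * pi'^-1)%g| * c =
      ((1 + x) ^+ #|fixed_points (pi * pi'^-1)%g| * (1 + x ^+ 2) ^+ k) ^+ m.
    by rewrite /w addrC subrK exprMn -!exprM mulnC.
  apply: lerXn2r.
  - have d3 : 0 <= delta <= 1 / 3.
      have : x <= k%:R * x by rewrite ler_peMl // ler1n.
      by rewrite d0 /=; move: kx; rewrite /x; nra.
    have dens_ge0 pi1 y : 0 <= edge_density (edge pi1) delta y.
      by case: (edge_density_balanced_tree pi1 d3) => S [_ _ [[]]].
    rewrite nnegrE mulr_ge0 // sumr_ge0 // => y _.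
    by rewrite mulr_ge0.
  - by rewrite nnegrE mulr_ge0 // exprn_ge0 // addr_ge0 // exprn_ge0.
  apply: le_trans (edge_density_inner pi pi' d0) _.
  rewrite -[in X in _ <= _ * X](card_ord k).
  apply: le_trans (prod_porbits_le _ _); last by rewrite x0 x1.
  apply: le_trans (sum_invariant_sets _ x0).
  rewrite [leLHS]big_mkcond [leRHS]big_mkcond; apply: ler_sum => F _.
  (* Equal images under [pi] and [pi'] make [F] invariant under [pi * pi'^-1]. *)
  case: ifP => [/eqP eqF|_]; last by case: ifP => // _; rewrite exprn_ge0.
  rewrite ifT //; apply/eqP.
  transitivity (pi'^-1%g @: (pi @: F)).
    by rewrite -imset_comp; apply: eq_imset => a; rewrite permM.
  rewrite eqF -imset_comp -[RHS]imset_id; apply: eq_imset => a /=.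
  by rewrite permK.
have row_le pi : \sum_pi' (N * \sum_y edge_density (edge pi) delta y
      * edge_density (edge pi') delta y) ^+ m <= k`!%:R / (1 - w) * c.
  apply: le_trans (ler_sum _ (fun pi' _ => pair_le pi pi')) _.
  (* Substituting [pi' = s^-1 * pi] turns [pi * pi'^-1] into [s], so the row bound does not depend
     on [pi]. *)
  rewrite (reindex_inj (h := fun s : 'S_k => (s^-1 * pi)%g)) /=; last first.
    by move=> s s' /mulIg/invg_inj.
  under eq_bigr do rewrite invMg invgK mulgA mulgV mul1g.
  rewrite -big_distrl ler_wpM2r // sum_expr_fixed_points // w0 /=; lra.
apply: le_lt_trans (ler_sum _ (fun pi _ => row_le pi)) _.
rewrite sumr_const card_Sn -[ltLHS]mulr_natr.
have f0 : 0 < k`!%:R :> R by rewrite ltr0n fact_gt0.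
have -> : k`!%:R / (1 - w) * c * k`!%:R = (c / (1 - w)) * k`!%:R ^+ 2 by ring.
rewrite ltr_pM2r ?exprn_gt0 // ltr_pdivrMr; lra.
Qed.

End MatchedNets.

(** * Sample lower bound for uniformity testing *)

(** A tester's guarantee covers balanced tree nets only, so the uniform distribution must be
    exhibited as one: zero bias on the empty graph. *)
Lemma uniform_balanced_tree (R : realType) n :
  balanced_tree_bayes_net (1 / 3) (uniform R n).
Proof.
have -> : uniform R n = bias_density (fun _ _ => 0).
  by apply/ffunP=> x; rewrite !ffunE big1 ?mulr1 // => i _; rewrite mulr0 addr0.
apply: (@bias_density_balanced_tree _ _ (fun _ _ => false)) => //.
  by move=> i x; rewrite normr0; lra.
by move=> i; rewrite [parents _ _](_ : _ = set0) ?cards0 //; apply/setP=> j; rewrite !inE.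
Qed.

Lemma uniformity_testing_lower_bound (R : realType) :
  requires_n_over_eps2_samples (1 / 3) (1 / 192 : R).
Proof.
(* The factor 1/32 is the bound wanted on [m delta^2], 1/64 undoes [eta = 64 eps], and the final 2
   comes from [n <= 2 (k' + 1)]. *)
pose K : R := 1 / 32 * (1 / 64) ^+ 2 / 2.
have K0 : 0 < K by rewrite /K; lra.
exists K => // eps /andP[eps0 eps1] n m T randT distT.
case: (posnP n) => [->|n_gt0]; first by rewrite mul0r mulr0.
(* This rounding gives [2 k' + 1 <= n <= 2 (k' + 1)] for either parity of [n]. *)
pose k' := n.-1./2.
have lt_kn : (k' + k' < n)%N.
  by rewrite addnn -[ltnRHS](prednK n_gt0) ltnS -[leqRHS]odd_double_half leq_addl.
have le_nk : (n <= k'.+1 * 2)%N.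
  rewrite -[leqLHS](prednK n_gt0) -[n.-1 in leqLHS]odd_double_half muln2 doubleS -/k'.
  by case: odd.
have nk : n%:R <= k'.+1%:R * 2 :> R by rewrite -natrM ler_nat.
rewrite leNgt; apply/negP => lt_m.
(* The distance bound [eta / 32 = 2 eps] strictly exceeds [eps], and [eps < 1/192] keeps [eta],
   hence [delta], at most 1/3. *)
pose eta : R := 64 * eps; pose r : R := Num.sqrt k'.+1%:R.
have r0 : 0 < r by rewrite sqrtr_gt0 ltr0n.
have rr : r * r = k'.+1%:R by rewrite -expr2 sqr_sqrtr.
have r1 : 1 <= r by rewrite -sqrtr1 ler_wsqrtr // ler1n.
pose delta := eta / r.
have eta0 : 0 < eta by rewrite /eta; lra.
have eta1 : eta <= 1 / 3 by rewrite /eta; lra.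
have d0 : 0 <= delta by rewrite divr_ge0 ?ltW.
have d3 : delta <= 1 / 3 by rewrite ler_pdivrMr //; lra.
have kdd : k'.+1%:R * (delta * delta) = eta * eta.
  by rewrite -rr /delta; field; rewrite gt_eqF.
have tree pi := edge_density_balanced_tree lt_kn pi (introT andP (conj d0 d3)).
have : m%:R * (delta * delta) < 1 / 32.
  have dd0 : 0 < delta * delta by rewrite mulr_gt0 // divr_gt0.
  have : m%:R * (delta * delta) < K * (n%:R / eps ^+ 2) * (delta * delta).
    by rewrite ltr_pM2r.
  move/lt_le_trans; apply.
  have -> : K * (n%:R / eps ^+ 2) * (delta * delta)
      = 1 / 64 * (n%:R / k'.+1%:R).
    by rewrite -rr /K /delta /eta; field; rewrite !gt_eqF.
  have : n%:R / k'.+1%:R <= 2 :> R by rewrite ler_pdivrMr ?ltr0n // mulrC.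
  by move: (n%:R / _) => u; lra.
have : k'.+1%:R * (delta * delta) <= 1 / 9 by rewrite kdd; nra.
move=> kd md; have := second_moment_lt lt_kn d0 kd md.
rewrite ltNge => /negP; apply; apply: (le_cam_second_moment _ randT).
- by rewrite card_Sn fact_gt0.
- by move=> pi; case: (tree pi) => S [_ _ [? _] _].
- by have [/(_ erefl)] := distT _ (uniform_balanced_tree R n).
move=> pi; have [_] := distT _ (tree pi); apply.
have : eta / 32 <= l1_dist (edge_density (edge lt_kn pi) delta) (uniform R n).
  apply: l1_dist_edge_density => //; [exact: edge_disjoint|exact: edge_neq0|].
  by rewrite eta0 /=; lra.
by rewrite /eta; lra.
Qed.

Theorem theorem6p1 (R : realType) :
  (exists c eps0 : R,
     [/\ 0 < c, 0 < eps0 & requires_n_over_eps2_samples c eps0]) /\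
  (exists eps0 : R, 0 < eps0 /\ requires_n_over_eps2_samples (1 / 3) eps0).
Proof.
have lb := uniformity_testing_lower_bound R.
by split; [exists (1 / 3), (1 / 192)|exists (1 / 192)]; split => //; lra.
Qed.
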